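(* Let $\lambda\ge0$, $\Delta t>0$, $m\in\{0,\dots,M-1\}$, and let $(\mathcal{V}^{m+1},\varkappa^{m+1},\vec X^{m+1},\kappa^{m+1})\in V^h\times V^h\times[V^h]^2\times V^h$ be a solution of the linear scheme (L) defined in the context. Then $$\mathcal{E}^{m+1}+\Delta t\,\bigl(\mathcal{V}^{m+1},\,\mathcal{V}^{m+1}|\vec X^m_\rho|\bigr)\le\mathcal{E}^m,$$ where $\mathcal{E}^m=\tfrac12\bigl((\varkappa^m)^2,\,|\vec X^{m-1}_\rho|\bigr)+\lambda\bigl(|\vec X^m_\rho|,\,1\bigr)$.
   Context: $\mathbb{I}=\mathbb{R}/\mathbb{Z}$ is partitioned uniformly into $\mathbb{I}_j=[\rho_{j-1},\rho_j]$, $j=1,\dots,J$, with $\rho_j=jh$, $h=1/J$ ($\rho_0$ and $\rho_J$ are identified). $V^h=\{\chi\in C^0(\mathbb{I}):\chi|_{\mathbb{I}_j}\text{ is affine for } j=1,\dots,J\}$. $(\cdot,\cdot)$ is the $L^2$-inner product over $\mathbb{I}$ (for scalar or vector valued functions), and the mass-lumped inner product is $$(u,v)^h=\frac h2\sum_{j=1}^J\bigl[(u\cdot v)(\rho_j^-)+(u\cdot v)(\rho_{j-1}^+)\bigr],$$ for piecewise continuous $u,v$ with possible jumps at the nodes, where $u(\rho_j^\pm)=\lim_{\delta\searrow0}u(\rho_j\pm\delta)$. Subscript $\rho$ denotes the derivative in $\rho$; $(\cdot)^\perp$ denotes clockwise rotation by $\pi/2$. $[0,T]$ is divided uniformly with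 time step $\Delta t=T/M$, $t_m=m\Delta t$. Throughout, $\vec X^m\in[V^h]^2$ with $|\vec X^m_\rho|>0$ in $\mathbb{I}$ for $m=0,\dots,M$. Set $\vec\tau^m=\vec X^m_\rho|\vec X^m_\rho|^{-1}$, $\vec\nu^m=-(\vec\tau^m)^\perp$, and $\mathcal{J}^m=|\vec X^{m-1}_\rho|/|\vec X^m_\rho|$. Linear scheme (L): given $\vec X^0\in[V^h]^2$ and $\varkappa^0\in V^h$, set $\vec X^{-1}=\vec X^0$ (so $\mathcal{J}^0=1$). For $m=0,\dots,M-1$ find $(\mathcal{V}^{m+1},\varkappa^{m+1},\vec X^{m+1},\kappa^{m+1})\in V^h\times V^h\times[V^h]^2\times V^h$ such that $$\bigl(\mathcal{V}^{m+1},\varphi^h|\vec X^m_\rho|\bigr)=\bigl(\varkappa^{m+1}_\rho,\varphi^h_\rho|\vec X^m_\rho|^{-1}\bigr)-\tfrac12\bigl((\varkappa^m)^2\varkappa^{m+1},\varphi^h|\vec X^m_\rho|\bigr)+\lambda\bigl(\kappa^{m+1},\varphi^h|\vec X^m_\rho|\bigr)\quad\forall\varphi^h\in V^h,$$ $$\Bigl(\frac{\varkappa^{m+1}-\varkappa^m\sqrt{\mathcal{J}^m}}{\Delta t},\chi^h|\vec X^m_\rho|\Bigr)=-\bigl(\mathcal{V}^{m+1}_\rho,\chi^h_\rho|\vec X^m_\rho|^{-1}\bigr)+\tfrac12\bigl((\varkappa^m)^2\mathcal{V}^{m+1},\chi^h|\vec X^m_\rho|\bigr)+\tfrac12\Bigl(\vec\tau^m\cdot\frac{\vec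 X^m-\vec X^{m-1}}{\Delta t},\ \varkappa^{m+1}_\rho\chi^h-\varkappa^{m+1}\chi^h_\rho\Bigr)\quad\forall\chi^h\in V^h,$$ $$\Bigl(\vec\nu^m\cdot\frac{\vec X^{m+1}-\vec X^m}{\Delta t},\xi^h|\vec X^m_\rho|\Bigr)^h=\bigl(\mathcal{V}^{m+1},\xi^h|\vec X^m_\rho|\bigr)\quad\forall\xi^h\in V^h,$$ $$\bigl(\kappa^{m+1}\vec\nu^m,\vec\eta^h|\vec X^m_\rho|\bigr)^h=-\bigl(\vec X^{m+1}_\rho,\vec\eta^h_\rho|\vec X^m_\rho|^{-1}\bigr)\quad\forall\vec\eta^h\in[V^h]^2.$$ Note that $\varkappa^{m}$ and $\kappa^{m}$ are two independent unknowns. *)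

(* Defs.v *)
(* Stdlib reals with Coquelicot. *)
From Stdlib Require Import Reals.
From Coquelicot Require Import Coquelicot.
Open Scope R_scope.

Definition mesh_size (J : nat) : R := / INR J.

Definition node (J j : nat) : R := INR j * mesh_size J.

Definition time_step (T : R) (M : nat) : R := T / INR M.

(* Functions on the circle R/Z are represented by 1-periodic functions on R,
   so that C^0(R/Z) corresponds to continuity at every real point. *)
Definition Vh (J : nat) (f : R -> R) : Prop :=
  (forall r, f (r + 1) = f r) /\
  (forall r, continuous f r) /\
  (forall j, (1 <= j <= J)%nat ->
     exists a b, forall r, node J (j - 1) <= r <= node J j -> f r = a + b * r).

Definition Vh2 (J : nat) (X : R -> R * R) : Prop :=
  Vh J (fun r => fst (X r)) /\ Vh J (fun r => snd (X r)).

Definition dot (v w : R * R) : R := fst v * fst w + snd v * snd w.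

(* Clockwise rotation by PI / 2. *)
Definition perp (v : R * R) : R * R := (snd v, - fst v).

(* On elements of [V^h]^2 this is the classical derivative away from the nodes;
   the value that [Derive] returns at a node never enters below, because
   integrals ignore it and the lumped product only uses one-sided limits. *)
Definition Dvec (X : R -> R * R) (r : R) : R * R :=
  (Derive (fun s => fst (X s)) r, Derive (fun s => snd (X s)) r).

(* [norm] on [R * R] is Coquelicot's product norm, i.e. the Euclidean norm. *)
Definition speed (X : R -> R * R) (r : R) : R := norm (Dvec X r).

Definition tangent (X : R -> R * R) (r : R) : R * R :=
  scal (/ speed X r) (Dvec X r).

Definition normal (X : R -> R * R) (r : R) : R * R := opp (perp (tangent X r)).

(* |X_rho| > 0: the derivative of a piecewise affine curve is only defined in
   the interior of the elements. *)
Definition regular (J : nat) (X : R -> R * R) : Prop :=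
  forall j, (1 <= j <= J)%nat ->
  forall r, node J (j - 1) < r < node J j -> 0 < speed X r.

Definition ip (u v : R -> R) : R := RInt (fun r => u r * v r) 0 1.

Definition ipv (u v : R -> R * R) : R := RInt (fun r => dot (u r) (v r)) 0 1.

Definition left_limit (f : R -> R) (x : R) : R := lim (filtermap f (at_left x)).

Definition right_limit (f : R -> R) (x : R) : R := lim (filtermap f (at_right x)).

Definition lump (J : nat) (w : R -> R) : R :=
  mesh_size J / 2 *
  sum_n_m (fun j => left_limit w (node J j) + right_limit w (node J (j - 1))) 1 J.

Definition iph (J : nat) (u v : R -> R) : R := lump J (fun r => u r * v r).

Definition iphv (J : nat) (u v : R -> R * R) : R :=
  lump J (fun r => dot (u r) (v r)).

(* The curve at level m - 1; truncated predecessor encodes X^{-1} = X^0. *)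
Definition Xprev (X : nat -> R -> R * R) (m : nat) : R -> R * R := X (Nat.pred m).

Definition Jac (X : nat -> R -> R * R) (m : nat) (r : R) : R :=
  speed (Xprev X m) r / speed (X m) r.

(* Step m of the linear scheme: the level-(m+1) entries of V, vk, X, kap solve
   the four variational equations for given X^m, X^{m-1} and vk^m.
   [vk] is the curvature variable evolved in time (varkappa), [kap] the
   independent one defined through the discrete curve (kappa). *)
Record scheme_step (J : nat) (dt lam : R)
    (V vk : nat -> R -> R) (X : nat -> R -> R * R) (kap : nat -> R -> R)
    (m : nat) : Prop := {
  V_in_Vh : Vh J (V (S m));
  vk_in_Vh : Vh J (vk (S m));
  X_in_Vh2 : Vh2 J (X (S m));
  kap_in_Vh : Vh J (kap (S m));

  velocity_eq : forall phi, Vh J phi ->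
    ip (V (S m)) (fun r => phi r * speed (X m) r) =
    ip (Derive (vk (S m))) (fun r => Derive phi r * / speed (X m) r)
    - / 2 * ip (fun r => (vk m r) ^ 2 * vk (S m) r)
               (fun r => phi r * speed (X m) r)
    + lam * ip (kap (S m)) (fun r => phi r * speed (X m) r);

  curvature_evolution_eq : forall chi, Vh J chi ->
    ip (fun r => (vk (S m) r - vk m r * sqrt (Jac X m r)) / dt)
       (fun r => chi r * speed (X m) r) =
    - ip (Derive (V (S m))) (fun r => Derive chi r * / speed (X m) r)
    + / 2 * ip (fun r => (vk m r) ^ 2 * V (S m) r)
               (fun r => chi r * speed (X m) r)
    + / 2 * ip (fun r => dot (tangent (X m) r)
                             (scal (/ dt) (minus (X m r) (Xprev X m r))))
               (fun r => Derive (vk (S m)) r * chi r - vk (S m) r * Derive chi r);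

  normal_motion_eq : forall xi, Vh J xi ->
    iph J (fun r => dot (normal (X m) r)
                        (scal (/ dt) (minus (X (S m) r) (X m r))))
          (fun r => xi r * speed (X m) r) =
    ip (V (S m)) (fun r => xi r * speed (X m) r);

  curvature_eq : forall eta, Vh2 J eta ->
    iphv J (fun r => scal (kap (S m) r) (normal (X m) r))
           (fun r => scal (speed (X m) r) (eta r)) =
    - ipv (Dvec (X (S m))) (fun r => scal (/ speed (X m) r) (Dvec eta r))
}.

Definition energy (lam : R) (vk : nat -> R -> R) (X : nat -> R -> R * R)
    (m : nat) : R :=
  / 2 * ip (fun r => (vk m r) ^ 2) (speed (Xprev X m))
  + lam * ip (speed (X m)) (fun _ => 1).

(* Main.v *)
(** Test the four equations with [V], [varkappa], [kappa] and the discrete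
    velocity [(X^{m+1} - X^m) / dt].  The elliptic terms cancel, the transport
    term is antisymmetric and vanishes, and the two lumped products coincide.
    What remains follows from two inequalities that hold on each element:
    [k (k - k0 sqrt J) >= (k^2 - k0^2 J) / 2] and
    [p . (p - q) / |q| >= |p| - |q|]. *)

Require Import Defs.
From Stdlib Require Import Reals Lra Lia FunctionalExtensionality.
From Coquelicot Require Import Coquelicot.
Open Scope R_scope.

(** * Piecewise functions on the mesh and their integrals *)

Definition in_element (J j : nat) (r : R) : Prop :=
  (1 <= j <= J)%nat /\ node J (j - 1) < r < node J j.

(** Each element has its own continuous extension [g] to the whole line, so [f] is bounded near the
    nodes and integrable up to them. Agreement is asked on open elements only, which leaves node
    values, such as those of [Derive], free. *)
Definition piecewise_continuous (J : nat) (f : R -> R) : Prop :=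
  forall j, (1 <= j <= J)%nat ->
  exists g, (forall x, continuous g x) /\ forall r, in_element J j r -> f r = g r.

Definition piecewise_constant (J : nat) (f : R -> R) : Prop :=
  forall j, (1 <= j <= J)%nat -> exists c, forall r, in_element J j r -> f r = c.

Lemma node_0 (J : nat) : node J 0 = 0.
Proof. unfold node; simpl; ring. Qed.

Lemma node_last (J : nat) : (1 <= J)%nat -> node J J = 1.
Proof.
  intros hJ; unfold node, mesh_size; apply Rinv_r, not_0_INR; lia.
Qed.

Lemma node_le_S (J n : nat) : (1 <= J)%nat -> node J n <= node J (S n).
Proof.
  intros hJ; unfold node, mesh_size; rewrite S_INR.
  assert (0 < / INR J) by (apply Rinv_0_lt_compat, lt_0_INR; lia).
  lra.
Qed.

Lemma in_element_S (J n : nat) (r : R) :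
  (S n <= J)%nat -> node J n < r < node J (S n) -> in_element J (S n) r.
Proof.
  intros hn hr; split; [lia|].
  replace (S n - 1)%nat with n by lia; exact hr.
Qed.

Lemma ex_RInt_element (J n : nat) (f : R -> R) :
  (S n <= J)%nat -> piecewise_continuous J f ->
  ex_RInt f (node J n) (node J (S n)).
Proof.
  intros hn hf.
  assert (hle : node J n <= node J (S n)) by (apply node_le_S; lia).
  destruct (hf (S n) ltac:(lia)) as [g [hg heq]].
  apply ex_RInt_ext with g.
  - rewrite Rmin_left, Rmax_right by exact hle.
    intros x hx; symmetry; apply heq, in_element_S; assumption.
  - apply (ex_RInt_continuous (V := R_CompleteNormedModule)); intros z _; apply hg.
Qed.

Lemma ex_RInt_node (J n : nat) (f : R -> R) :
  (n <= J)%nat -> piecewise_continuous J f -> ex_RInt f (node J 0) (node J n).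
Proof.
  induction n as [|n IH]; intros hn hf.
  - apply ex_RInt_point.
  - apply ex_RInt_Chasles with (node J n).
    + apply IH; [lia | exact hf].
    + now apply ex_RInt_element.
Qed.

Lemma ex_RInt_piecewise (J : nat) (f : R -> R) :
  (1 <= J)%nat -> piecewise_continuous J f -> ex_RInt f 0 1.
Proof.
  intros hJ hf.
  rewrite <- (node_0 J), <- (node_last J hJ); now apply ex_RInt_node.
Qed.

(** The integral is split over the elements by Chasles, with induction on the last node; the
    pointwise bound is thus needed only away from the nodes. *)
Lemma RInt_le_piecewise (J : nat) (f g : R -> R) :
  (1 <= J)%nat -> piecewise_continuous J f -> piecewise_continuous J g ->
  (forall j r, in_element J j r -> f r <= g r) ->
  RInt f 0 1 <= RInt g 0 1.
Proof.
  intros hJ hf hg hle.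
  enough (H : forall n, (n <= J)%nat ->
    RInt f (node J 0) (node J n) <= RInt g (node J 0) (node J n)).
  { rewrite <- (node_0 J), <- (node_last J hJ); now apply H. }
  induction n as [|n IH]; intros hn.
  - rewrite !RInt_point; apply Rle_refl.
  - assert (hn' : (n <= J)%nat) by lia.
    rewrite <- (RInt_Chasles f (node J 0) (node J n) (node J (S n)))
      by (apply ex_RInt_node || apply ex_RInt_element; assumption).
    rewrite <- (RInt_Chasles g (node J 0) (node J n) (node J (S n)))
      by (apply ex_RInt_node || apply ex_RInt_element; assumption).
    apply Rplus_le_compat; [now apply IH|].
    apply RInt_le; try (apply ex_RInt_element; assumption).
    + now apply node_le_S.
    + intros x hx; apply (hle (S n)), in_element_S; assumption.
Qed.

Lemma piecewise_constant_continuous (J : nat) (f : R -> R) :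
  piecewise_constant J f -> piecewise_continuous J f.
Proof.
  intros hf j hj; destruct (hf j hj) as [c hc].
  exists (fun _ => c); split; [intros x; apply continuous_const | exact hc].
Qed.

Lemma piecewise_constant_cst (J : nat) (c : R) : piecewise_constant J (fun _ => c).
Proof. intros j _; now exists c. Qed.

(** Constants survive any operation, continuous or not. Norms, quotients and square roots of element
    slopes are handled this way, with no discussion of vanishing denominators. *)
Lemma piecewise_constant_op (op : R -> R -> R) (J : nat) (f g : R -> R) :
  piecewise_constant J f -> piecewise_constant J g ->
  piecewise_constant J (fun r => op (f r) (g r)).
Proof.
  intros hf hg j hj.
  destruct (hf j hj) as [a ha], (hg j hj) as [b hb].
  exists (op a b); intros r hr; now rewrite (ha r hr), (hb r hr).
Qed.

Lemma piecewise_continuous_plus (J : nat) (f g : R -> R) :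
  piecewise_continuous J f -> piecewise_continuous J g ->
  piecewise_continuous J (fun r => f r + g r).
Proof.
  intros hf hg j hj.
  destruct (hf j hj) as [a [ca ha]], (hg j hj) as [b [cb hb]].
  exists (fun r => a r + b r); split.
  - intros x; apply (continuous_plus a b); auto.
  - intros r hr; now rewrite (ha r hr), (hb r hr).
Qed.

Lemma piecewise_continuous_mult (J : nat) (f g : R -> R) :
  piecewise_continuous J f -> piecewise_continuous J g ->
  piecewise_continuous J (fun r => f r * g r).
Proof.
  intros hf hg j hj.
  destruct (hf j hj) as [a [ca ha]], (hg j hj) as [b [cb hb]].
  exists (fun r => a r * b r); split.
  - intros x; apply (continuous_mult a b); auto.
  - intros r hr; now rewrite (ha r hr), (hb r hr).
Qed.

Lemma piecewise_continuous_cst (J : nat) (c : R) :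
  piecewise_continuous J (fun _ => c).
Proof. apply piecewise_constant_continuous, piecewise_constant_cst. Qed.

Lemma piecewise_continuous_minus (J : nat) (f g : R -> R) :
  piecewise_continuous J f -> piecewise_continuous J g ->
  piecewise_continuous J (fun r => f r - g r).
Proof.
  intros hf hg.
  replace (fun r => f r - g r) with (fun r => f r + (-1) * g r)
    by (apply functional_extensionality; intros r; ring).
  apply piecewise_continuous_plus; [exact hf|].
  apply piecewise_continuous_mult; [apply piecewise_continuous_cst | exact hg].
Qed.

(** * Finite element functions and their derivatives on one element *)

Lemma Vh_piecewise_continuous (J : nat) (f : R -> R) :
  Vh J f -> piecewise_continuous J f.
Proof. intros [_ [hc _]] j _; exists f; split; [exact hc | reflexivity]. Qed.

(** The element is open, so [f] coincides with its affine formula near each of its points, and one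
    slope serves the whole element. *)
Lemma Vh_is_derive (J j : nat) (f : R -> R) : (1 <= j <= J)%nat -> Vh J f ->
  exists b, forall r, in_element J j r -> is_derive f r b.
Proof.
  intros hj [_ [_ haff]]; destruct (haff j hj) as [a [b hab]].
  exists b; intros r [_ [hl hr]].
  apply is_derive_ext_loc with (fun r => a + b * r).
  - apply locally_interval with (node J (j - 1)) (node J j); simpl; try assumption.
    intros y h1 h2; symmetry; apply hab; lra.
  - auto_derive; [exact I | ring].
Qed.

Lemma Vh_ex_derive (J j : nat) (f : R -> R) (r : R) :
  Vh J f -> in_element J j r -> ex_derive f r.
Proof.
  intros hf hr; destruct (Vh_is_derive J j f (proj1 hr) hf) as [b hb].
  exists b; now apply hb.
Qed.

Lemma Derive_Vh_piecewise_constant (J : nat) (f : R -> R) :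
  Vh J f -> piecewise_constant J (Derive f).
Proof.
  intros hf j hj; destruct (Vh_is_derive J j f hj hf) as [b hb].
  exists b; intros r hr; now apply is_derive_unique, hb.
Qed.

Lemma speed_piecewise_constant (J : nat) (X : R -> R * R) :
  Vh2 J X -> piecewise_constant J (speed X).
Proof.
  intros [h1 h2].
  apply (piecewise_constant_op (fun a b => norm (a, b)));
    now apply Derive_Vh_piecewise_constant.
Qed.

(** Applied to each component, this makes the discrete velocity an admissible test function. *)
Lemma Vh_scal_minus (J : nat) (c : R) (f g : R -> R) :
  Vh J f -> Vh J g -> Vh J (fun r => c * (f r - g r)).
Proof.
  intros [pf [cf af]] [pg [cg ag]]; split; [|split].
  - intros r; now rewrite pf, pg.
  - intros r; apply (continuous_scal_r c (fun r => f r - g r)).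
    apply (continuous_minus f g); auto.
  - intros j hj; destruct (af j hj) as [a [b hab]], (ag j hj) as [a' [b' hab']].
    exists (c * (a - a')), (c * (b - b')); intros r hr.
    rewrite (hab r hr), (hab' r hr); ring.
Qed.

Lemma Derive_scal_minus (c : R) (f g : R -> R) (r : R) :
  ex_derive f r -> ex_derive g r ->
  Derive (fun s => c * (f s - g s)) r = c * (Derive f r - Derive g r).
Proof. intros hf hg; rewrite Derive_scal, Derive_minus; auto. Qed.

(** * Pointwise inequalities in the plane and for the curvature *)

Lemma norm_sqr (v : R * R) : norm v * norm v = dot v v.
Proof.
  unfold norm; simpl; unfold prod_norm, norm; simpl; unfold abs; simpl.
  rewrite !Rmult_1_r, <- !Rabs_mult, !Rabs_pos_eq by apply Rle_0_sqr.
  apply sqrt_sqrt, Rplus_le_le_0_compat; apply Rle_0_sqr.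
Qed.

Lemma norm_plane_ge_0 (v : R * R) : 0 <= norm v.
Proof.
  apply (norm_ge_0 (V := prod_NormedModule R_AbsRing R_NormedModule R_NormedModule)).
Qed.

(** Cauchy-Schwarz: by Lagrange's identity the squares of the two sides differ by the square of the
    cross product. *)
Lemma dot_le_norm (v w : R * R) : dot v w <= norm v * norm w.
Proof.
  apply Rsqr_incr_0_var; [|apply Rmult_le_pos; apply norm_plane_ge_0].
  unfold Rsqr.
  replace (norm v * norm w * (norm v * norm w))
    with ((norm v * norm v) * (norm w * norm w)) by ring.
  rewrite !norm_sqr; unfold dot.
  pose proof (Rle_0_sqr (fst v * snd w - snd v * fst w)) as H; unfold Rsqr in H.
  lra.
Qed.

(** After multiplication by [norm q], Cauchy-Schwarz bounds [dot p q], and what is left is the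
    square of [norm p - norm q]. *)
Lemma norm_sub_le_dot (p q : R * R) : 0 < norm q ->
  norm p - norm q <= / norm q * (dot p p - dot p q).
Proof.
  intros hq.
  apply Rmult_le_reg_l with (norm q); [exact hq|].
  rewrite <- Rmult_assoc, Rinv_r, Rmult_1_l, <- norm_sqr by lra.
  pose proof (dot_le_norm p q).
  pose proof (Rle_0_sqr (norm p - norm q)) as H1; unfold Rsqr in H1.
  lra.
Qed.

(** With [q = sqrt (s0 / s)] one has [q * q * s = s0], and the right side exceeds the left by half
    of [(k - k0 * q) ^ 2 * s]. The factor [q] thus moves the old energy onto the old length
    element. *)
Lemma curvature_energy_le (k k0 s s0 : R) : 0 < s -> 0 <= s0 ->
  / 2 * (k ^ 2 * s) - / 2 * (k0 ^ 2 * s0) <= (k - k0 * sqrt (s0 / s)) * (k * s).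
Proof.
  intros hs hs0.
  assert (hq : sqrt (s0 / s) * sqrt (s0 / s) * s = s0).
  { rewrite sqrt_sqrt; [field; lra|].
    apply Rdiv_le_0_compat; assumption. }
  set (q := sqrt (s0 / s)) in *.
  pose proof (Rmult_le_pos _ _ (Rle_0_sqr (k - k0 * q)) (Rlt_le _ _ hs)) as H.
  unfold Rsqr in H; rewrite <- hq; lra.
Qed.

(** * The two inequalities integrated over the circle *)

Lemma RInt_lin2 (f g : R -> R) (a b : R) : ex_RInt f 0 1 -> ex_RInt g 0 1 ->
  RInt (fun r => a * f r - b * g r) 0 1 = a * RInt f 0 1 - b * RInt g 0 1.
Proof.
  intros hf hg; apply is_RInt_unique.
  apply (is_RInt_minus (fun r => a * f r) (fun r => b * g r));
    apply (is_RInt_scal (V := R_NormedModule)), (RInt_correct (V := R_CompleteNormedModule));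
    assumption.
Qed.

Lemma RInt_scal_R (f : R -> R) (a : R) : ex_RInt f 0 1 ->
  RInt (fun r => a * f r) 0 1 = a * RInt f 0 1.
Proof. intros hf; now apply (RInt_scal (V := R_CompleteNormedModule)). Qed.

Ltac piecewise_tac :=
  repeat first
    [ assumption
    | apply piecewise_continuous_cst
    | apply piecewise_continuous_minus
    | apply piecewise_continuous_mult
    | apply piecewise_continuous_plus ].

(** In use, [X] is the current curve and [Y] the previous one; the right side is [dt] times the left
    side of the curvature evolution equation tested with [k]. *)
Lemma curvature_energy_integral_le (J : nat) (dt : R) (k k0 : R -> R)
    (X Y : R -> R * R) :
  (1 <= J)%nat -> 0 < dt -> Vh J k -> Vh J k0 ->
  Vh2 J X -> regular J X -> Vh2 J Y ->
  / 2 * ip (fun r => k r ^ 2) (speed X) - / 2 * ip (fun r => k0 r ^ 2) (speed Y) <=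
  dt * ip (fun r => (k r - k0 r * sqrt (speed Y r / speed X r)) / dt)
          (fun r => k r * speed X r).
Proof.
  intros hJ hdt hk hk0 hX hreg hY; unfold ip.
  apply Vh_piecewise_continuous in hk, hk0.
  pose proof (piecewise_constant_continuous _ _ (speed_piecewise_constant _ _ hX)) as cX.
  pose proof (piecewise_constant_continuous _ _ (speed_piecewise_constant _ _ hY)) as cY.
  assert (cJ : piecewise_continuous J (fun r => sqrt (speed Y r / speed X r))).
  { apply piecewise_constant_continuous.
    apply (piecewise_constant_op (fun a b => sqrt (a / b)));
      now apply speed_piecewise_constant. }
  rewrite <- RInt_lin2, <- RInt_scal_R.
  2, 3, 4: apply ex_RInt_piecewise with J; [exact hJ|]; unfold Rdiv; simpl;
    piecewise_tac.
  apply RInt_le_piecewise with J; [exact hJ | | |].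
  1, 2: unfold Rdiv; simpl; piecewise_tac.
  intros j r hr.
  replace (dt * ((k r - k0 r * sqrt (speed Y r / speed X r)) / dt * (k r * speed X r)))
    with ((k r - k0 r * sqrt (speed Y r / speed X r)) * (k r * speed X r))
    by (field; lra).
  apply curvature_energy_le.
  - exact (hreg j (proj1 hr) r (proj2 hr)).
  - apply norm_plane_ge_0.
Qed.

(** Here [X] is the current curve and [Y] the next one. On each element this is [norm_sub_le_dot]
    for the two derivatives, with [dt] cancelling the [/ dt] of the discrete velocity. *)
Lemma length_difference_le (J : nat) (dt : R) (X Y : R -> R * R) :
  (1 <= J)%nat -> 0 < dt -> Vh2 J X -> regular J X -> Vh2 J Y ->
  ip (speed Y) (fun _ => 1) - ip (speed X) (fun _ => 1) <=
  dt * ipv (Dvec Y) (fun r => scal (/ speed X r)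
         (Dvec (fun s => scal (/ dt) (minus (Y s) (X s))) r)).
Proof.
  intros hJ hdt hX hreg hY; unfold ip, ipv.
  pose proof (speed_piecewise_constant _ _ hX) as cX.
  pose proof (speed_piecewise_constant _ _ hY) as cY.
  assert (hZ : Vh2 J (fun s => scal (/ dt) (minus (Y s) (X s)))).
  { split; apply Vh_scal_minus; apply hX || apply hY. }
  set (Z := fun s => scal (/ dt) (minus (Y s) (X s))) in *.
  assert (cD : piecewise_continuous J
    (fun r => dot (Dvec Y r) (scal (/ speed X r) (Dvec Z r)))).
  { apply piecewise_constant_continuous.
    assert (D1 := Derive_Vh_piecewise_constant _ _ (proj1 hY)).
    assert (D2 := Derive_Vh_piecewise_constant _ _ (proj2 hY)).
    assert (D3 := Derive_Vh_piecewise_constant _ _ (proj1 hZ)).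
    assert (D4 := Derive_Vh_piecewise_constant _ _ (proj2 hZ)).
    apply (piecewise_constant_op Rplus); apply (piecewise_constant_op Rmult);
      try assumption;
      apply (piecewise_constant_op (fun a b => / a * b)); assumption. }
  apply piecewise_constant_continuous in cX, cY.
  (* The factors 1 bring the difference into the shape of [RInt_lin2]. *)
  rewrite <- (Rmult_1_l (RInt (fun r => speed Y r * 1) 0 1)),
          <- (Rmult_1_l (RInt (fun r => speed X r * 1) 0 1)).
  rewrite <- RInt_lin2, <- RInt_scal_R.
  2, 3, 4: apply ex_RInt_piecewise with J; piecewise_tac.
  apply RInt_le_piecewise with J; [exact hJ | | |].
  1, 2: piecewise_tac.
  intros j r hr.
  rewrite !Rmult_1_l, !Rmult_1_r.
  eapply Rle_trans.
  - apply (norm_sub_le_dot (Dvec Y r) (Dvec X r)).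
    exact (hreg j (proj1 hr) r (proj2 hr)).
  - fold (speed X r); apply Req_le.
    (* Linearity of the derivative is available because [r] is interior to an element, where both
       curves are differentiable. *)
    assert (EZ : Dvec Z r = scal (/ dt) (minus (Dvec Y r) (Dvec X r))).
    { apply injective_projections; apply Derive_scal_minus;
        apply Vh_ex_derive with J j; solve [exact hr | apply hX | apply hY]. }
    rewrite EZ; unfold dot, scal, minus, plus, opp; simpl.
    unfold scal, plus, opp; simpl; unfold mult; simpl.
    assert (hs := hreg j (proj1 hr) r (proj2 hr)).
    field; split; lra.
Qed.

(** * Energy decay for one step of the scheme *)

Theorem theorem5 (J M : nat) (T lam : R)
    (V vk : nat -> R -> R) (X : nat -> R -> R * R) (kap : nat -> R -> R) (m : nat)
    (hJ : (1 <= J)%nat)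
    (hlam : 0 <= lam)
    (hdt : 0 < time_step T M)
    (hm : (m < M)%nat)
    (hX : forall k, (k <= M)%nat -> Vh2 J (X k) /\ regular J (X k))
    (hvk : Vh J (vk m))
    (hstep : scheme_step J (time_step T M) lam V vk X kap m) :
  energy lam vk X (S m)
    + time_step T M * ip (V (S m)) (fun r => V (S m) r * speed (X m) r)
  <= energy lam vk X m.
Proof.
  destruct hstep as [hV hk hXS hkap e1 e2 e3 e4].
  set (dt := time_step T M) in *.
  destruct (hX m ltac:(lia)) as [hXm hreg].
  (* The truncated predecessor also covers [m = 0], where the previous curve is [X 0] itself. *)
  assert (hXp : Vh2 J (Xprev X m)) by (apply hX; lia).
  set (eta := fun r => scal (/ dt) (minus (X (S m) r) (X m r))).
  assert (heta : Vh2 J eta).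
  { split; apply Vh_scal_minus; apply hXS || apply hXm. }
  specialize (e1 _ hV); specialize (e2 _ hk); specialize (e3 _ hkap).
  specialize (e4 _ heta).
  (* The integrands agree at every point, so no one-sided limit has to be computed. *)
  assert (elump : iph J (fun r => dot (normal (X m) r) (eta r))
                        (fun r => kap (S m) r * speed (X m) r) =
                  iphv J (fun r => scal (kap (S m) r) (normal (X m) r))
                         (fun r => scal (speed (X m) r) (eta r))).
  { unfold iph, iphv; f_equal; apply functional_extensionality; intros r.
    unfold dot, scal; simpl; unfold scal; simpl; unfold mult; simpl; ring. }
  assert (eanti : forall w, ip w (fun r => Derive (vk (S m)) r * vk (S m) r
                                   - vk (S m) r * Derive (vk (S m)) r) = 0).
  { intros w; unfold ip.
    transitivity (RInt (fun _ => 0) 0 1).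
    { f_equal; apply functional_extensionality; intros r; ring. }
    rewrite RInt_const; unfold scal; simpl; unfold mult; simpl; ring. }
  rewrite eanti in e2.
  assert (eell : ip (Derive (vk (S m))) (fun r => Derive (V (S m)) r * / speed (X m) r) =
                 ip (Derive (V (S m))) (fun r => Derive (vk (S m)) r * / speed (X m) r)).
  { unfold ip; f_equal; apply functional_extensionality; intros r; ring. }
  assert (ecub : ip (fun r => vk m r ^ 2 * vk (S m) r) (fun r => V (S m) r * speed (X m) r) =
                 ip (fun r => vk m r ^ 2 * V (S m) r) (fun r => vk (S m) r * speed (X m) r)).
  { unfold ip; f_equal; apply functional_extensionality; intros r; ring. }
  assert (elam : ip (kap (S m)) (fun r => V (S m) r * speed (X m) r) =
                 ip (V (S m)) (fun r => kap (S m) r * speed (X m) r)).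
  { unfold ip; f_equal; apply functional_extensionality; intros r; ring. }
  pose proof (curvature_energy_integral_le J dt (vk (S m)) (vk m) (X m) (Xprev X m)
    hJ hdt hk hvk hXm hreg hXp) as bcurv.
  pose proof (length_difference_le J dt (X m) (X (S m)) hJ hdt hXm hreg hXS) as blen.
  fold eta in blen.
  unfold Jac in e2.
  change (iph J (fun r => dot (normal (X m) r) (eta r))
                (fun r => kap (S m) r * speed (X m) r) =
          ip (V (S m)) (fun r => kap (S m) r * speed (X m) r)) in e3.
  (* The new curvature energy is weighted by the current curve, as in [bcurv]. *)
  unfold energy; change (Xprev X (S m)) with (X m).
  apply (Rmult_le_compat_l lam _ _ hlam) in blen.
  (* The [kap] term of [e1] becomes [- lam] times the integral in [blen]. The elliptic and cubic
     terms of [e1] appear in [e2] with opposite signs, so they cancel once [e1] is multiplied by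
     [dt] and added to [bcurv]. *)
  rewrite eell, ecub, elam, <- e3, elump, e4 in e1.
  rewrite e2 in bcurv.
  rewrite e1.
  lra.
Qed.
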